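(* Let $X$ be a connected non-bipartite graph. If the discrete fundamental group $\pi_1(X)$ is torsion (every element has finite order), then $\chi(X)\geq 4$.
   Context: A walk of length $\ell$ in $X$ is a sequence $v_0\cdots v_\ell$ of vertices with $v_iv_{i+1}$ an edge for all $0\le i<\ell$. Two walks are homotopy equivalent if one can be transformed into the other by a finite sequence of the moves: (Sub) for $0<i<\ell$, replace $v_i$ by any common neighbor of $v_{i-1}$ and $v_{i+1}$; (Ins) for $0\le i\le\ell$, replace $v_i$ by $v_iwv_i$ for some neighbor $w$ of $v_i$; (Del) for $0<i<\ell$ with $v_{i-1}=v_{i+1}$, replace $v_{i-1}v_iv_{i+1}$ by $v_{i-1}$. For a vertex $v_0$, the discrete fundamental group $\pi_1(X,v_0)$ is the set of closed walks starting and ending at $v_0$ modulo homotopy equivalence, with group operation induced by concatenation; for connected $X$ it is independent of $v_0$ up to isomorphism and is written $\pi_1(X)$. $\chi(X)$ is the chromatic number. *)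

(* Defs.v *)
From HB Require Import structures.
From Stdlib Require Import Relations.
From mathcomp Require Import all_boot all_order all_algebra.
From mathcomp Require Import boolp classical_sets constructive_ereal.

Set Implicit Arguments.
Unset Strict Implicit.
Unset Printing Implicit Defensive.

Local Open Scope classical_set_scope.
Local Open Scope quotient_scope.

(* Simple graphs; the vertex set may be infinite. *)
Record sgraph := SGraph {
  vertex :> Type;
  adj : rel vertex;
  adj_sym : symmetric adj;
  adj_irr : irreflexive adj }.

Definition connected (X : sgraph) : Prop :=
  forall x y : X, exists2 p : seq X, path (@adj X) x p & last x p = y.

Definition bipartite (X : sgraph) : Prop :=
  exists A B : set X,
    [/\ A `|` B = setT, A `&` B = set0 &
        forall x y : X, adj x y -> (A x /\ B y) \/ (B x /\ A y)].

Definition colorable (X : sgraph) (k : nat) : Prop :=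
  exists c : X -> 'I_k, forall x y : X, adj x y -> c x <> c y.

(* All infinite chromatic numbers are identified with +oo. *)
Definition chromatic_number (X : sgraph) : \bar int :=
  match pselect (exists k, `[< colorable X k >]) with
  | left h => (Posz (ex_minn h))%:E
  | right _ => +oo%E
  end.

Section Homotopy.
Variable X : sgraph.
Implicit Types (x y v w : X) (s t p q : seq X).

(* A walk v_0 ... v_l is a nonempty sequence v_0 :: p with path adj v_0 p.
   A move applied to a walk yields a walk with the same ends (sorted_move,
   head_move, last_move), so only its source has to be assumed a walk. *)
Inductive move : seq X -> seq X -> Prop :=
| move_sub s t x v w y : adj x w -> adj w y ->
    move (s ++ [:: x; v; y] ++ t) (s ++ [:: x; w; y] ++ t)
| move_ins s t v w : adj v w ->
    move (s ++ [:: v] ++ t) (s ++ [:: v; w; v] ++ t)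
| move_del s t v w :
    move (s ++ [:: v; w; v] ++ t) (s ++ [:: v] ++ t).

Definition homotopic : seq X -> seq X -> Prop := clos_refl_trans _ move.

Lemma sorted_move s t : move s t -> sorted (@adj X) s -> sorted (@adj X) t.
Proof.
case=> {s t} [[|a s] t x v w y xw wy|[|a s] t v w vw|[|a s] t v w] /=.
- by rewrite xw wy => /and3P[].
- by rewrite !cat_path /= xw wy => /and5P[-> -> _ _ ->].
- by rewrite vw adj_sym vw.
- by rewrite !cat_path /= vw [adj w v]adj_sym vw.
- by move=> /and3P[].
- by rewrite !cat_path /= => /and5P[-> -> _ _ ->].
Qed.

Lemma last_move x0 s t : move s t -> last x0 s = last x0 t.
Proof. by case=> {s t} *; rewrite !last_cat. Qed.

Lemma head_move x0 s t : move s t -> head x0 s = head x0 t.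
Proof. by case=> {s t} [[]|[]|[]]. Qed.

Lemma move_rev s t : move s t -> move (rev s) (rev t).
Proof.
case=> {s t} [s t x v w y xw wy|s t v w vw|s t v w]; rewrite !rev_cat -!catA.
- by apply: move_sub; rewrite adj_sym.
- exact: move_ins.
- exact: move_del.
Qed.

Lemma move_cat a b s t : move s t -> move (a ++ s ++ b) (a ++ t ++ b).
Proof.
by case=> {s t} *; rewrite -!catA !(catA a);
  [apply: move_sub|apply: move_ins|apply: move_del].
Qed.

Lemma move_walk_sym s t : sorted (@adj X) s -> move s t -> move t s.
Proof.
move=> ss st; case: st ss => {s t} [s t x v w y _ _|s t v w _|s t v w].
- by move=> /cat_sorted2[_] /and3P[xv vy _]; apply: move_sub.
- by move=> _; apply: move_del.
- by move=> /cat_sorted2[_] /and3P[vw _ _]; apply: move_ins.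
Qed.

Lemma homotopic_refl s : homotopic s s.
Proof. exact: rt_refl. Qed.

Lemma homotopic_trans t s u : homotopic s t -> homotopic t u -> homotopic s u.
Proof. exact: rt_trans. Qed.

Lemma homotopic_sym s t : sorted (@adj X) s -> homotopic s t -> homotopic t s.
Proof.
move=> ss h; suff [] : sorted (@adj X) t /\ homotopic t s by [].
elim: h ss => {s t} [s t st ss|s ss|s t u _ IH1 _ IH2 ss].
- by split; [apply: sorted_move st ss|apply/rt_step/move_walk_sym].
- by split=> //; apply: rt_refl.
- have [tS ts] := IH1 ss; have [uS ut] := IH2 tS.
  by split=> //; apply: rt_trans ut ts.
Qed.

Lemma homotopic_rev s t : homotopic s t -> homotopic (rev s) (rev t).
Proof.
elim=> {s t} [s t /move_rev|s|s t u _ st _ tu]; first exact: rt_step.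
- exact: rt_refl.
- exact: rt_trans st tu.
Qed.

Lemma homotopic_cat a b s t :
  homotopic s t -> homotopic (a ++ s ++ b) (a ++ t ++ b).
Proof.
elim=> {s t} [s t /(move_cat a b)|s|s t u _ st _ tu]; first exact: rt_step.
- exact: rt_refl.
- exact: rt_trans st tu.
Qed.

Lemma homotopic_backtrack x p :
  homotopic (x :: p ++ rev (belast x p)) [:: x].
Proof.
elim: p x => [|y p IH] x /=; first exact: rt_refl.
rewrite rev_cons -cats1 catA.
apply: (@homotopic_trans [:: x; y; x]).
  exact: (homotopic_cat [:: x] [:: x] (IH y)).
exact/rt_step/(move_del [::] [::] x y).
Qed.

End Homotopy.

Section FundamentalGroup.
Variables (X : sgraph) (v0 : X).

(* The closed walk v0 :: walk_tail. *)
Record closed_walk := ClosedWalk {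
  walk_tail : seq X;
  walk_path : path (@adj X) v0 walk_tail;
  walk_last : last v0 walk_tail = v0 }.

HB.instance Definition _ := gen_eqMixin closed_walk.
HB.instance Definition _ := gen_choiceMixin closed_walk.

Implicit Types p q r : closed_walk.

Definition cw_homotopic : rel closed_walk :=
  fun p q => `[< homotopic (v0 :: walk_tail p) (v0 :: walk_tail q) >].

Lemma cw_homotopic_refl : reflexive cw_homotopic.
Proof. by move=> p; apply/asboolP/homotopic_refl. Qed.

Lemma cw_homotopic_sym : symmetric cw_homotopic.
Proof.
by move=> p q; apply/asboolP/asboolP; apply: homotopic_sym; apply: walk_path.
Qed.

Lemma cw_homotopic_trans : transitive cw_homotopic.
Proof.
by move=> q p r /asboolP pq /asboolP qr; apply/asboolP/(homotopic_trans pq qr).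
Qed.

Canonical cw_homotopic_equiv := EquivRel cw_homotopic
  cw_homotopic_refl cw_homotopic_sym cw_homotopic_trans.

Definition cw_one : closed_walk := @ClosedWalk [::] isT erefl.

Lemma cw_cat_path p q : path (@adj X) v0 (walk_tail p ++ walk_tail q).
Proof. by rewrite cat_path walk_last !walk_path. Qed.

Lemma cw_cat_last p q : last v0 (walk_tail p ++ walk_tail q) = v0.
Proof. by rewrite last_cat !walk_last. Qed.

Definition cw_cat p q : closed_walk :=
  ClosedWalk (cw_cat_path p q) (cw_cat_last p q).

Lemma cw_rev_cons p :
  v0 :: rev (belast v0 (walk_tail p)) = rev (v0 :: walk_tail p).
Proof. by rewrite [in RHS]lastI walk_last rev_rcons. Qed.

Lemma cw_rev_path p : path (@adj X) v0 (rev (belast v0 (walk_tail p))).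
Proof.
rewrite -{1}(walk_last p) rev_path (eq_path (e' := @adj X)) ?walk_path //.
by move=> x y; apply: adj_sym.
Qed.

Lemma cw_rev_last p : last v0 (rev (belast v0 (walk_tail p))) = v0.
Proof.
by rewrite -[LHS]/(last v0 (v0 :: _)) cw_rev_cons rev_cons last_rcons.
Qed.

Definition cw_rev p : closed_walk := ClosedWalk (cw_rev_path p) (cw_rev_last p).

Definition pi1 : Type := {eq_quot cw_homotopic}.
HB.instance Definition _ := Choice.on pi1.

Definition pi1_class (p : closed_walk) : pi1 := \pi_{eq_quot cw_homotopic} p.

Lemma pi1_classP p q : pi1_class p = pi1_class q <->
  homotopic (v0 :: walk_tail p) (v0 :: walk_tail q).
Proof.
split=> [/eqmodP/asboolP//|h]; exact/eqmodP/asboolP.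
Qed.

Lemma pi1_class_surj (g : pi1) : exists p, g = pi1_class p.
Proof. by exists (repr g); rewrite /pi1_class reprK. Qed.

Definition pi1_one : pi1 := pi1_class cw_one.
Definition pi1_mul (g h : pi1) : pi1 := pi1_class (cw_cat (repr g) (repr h)).
Definition pi1_inv (g : pi1) : pi1 := pi1_class (cw_rev (repr g)).

Lemma pi1_reprP p : homotopic (v0 :: walk_tail (repr (pi1_class p)))
                              (v0 :: walk_tail p).
Proof. by apply/pi1_classP; rewrite /pi1_class reprK. Qed.

Lemma pi1_mul_class p q :
  pi1_mul (pi1_class p) (pi1_class q) = pi1_class (cw_cat p q).
Proof.
apply/pi1_classP => /=.
apply: (@homotopic_trans _ (v0 :: walk_tail p ++ walk_tail (repr (pi1_class q)))).
  exact: (homotopic_cat [::] _ (pi1_reprP p)).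
have E r : v0 :: walk_tail p ++ walk_tail r =
    belast v0 (walk_tail p) ++ (v0 :: walk_tail r) ++ [::].
  by rewrite cats0 -cat_cons lastI walk_last cat_rcons.
by rewrite !E; apply/homotopic_cat/pi1_reprP.
Qed.

Lemma pi1_inv_class p : pi1_inv (pi1_class p) = pi1_class (cw_rev p).
Proof.
apply/pi1_classP => /=.
by rewrite !cw_rev_cons; apply/homotopic_rev/pi1_reprP.
Qed.

Lemma pi1_mulA : associative pi1_mul.
Proof.
move=> g h k; have [p ->] := pi1_class_surj g; have [q ->] := pi1_class_surj h.
have [r ->] := pi1_class_surj k; rewrite !pi1_mul_class.
by apply/pi1_classP; rewrite /= catA; apply: homotopic_refl.
Qed.

Lemma pi1_mul1g : left_id pi1_one pi1_mul.
Proof.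
move=> g; have [p ->] := pi1_class_surj g; rewrite pi1_mul_class.
exact/pi1_classP/homotopic_refl.
Qed.

Lemma pi1_mulg1 : right_id pi1_one pi1_mul.
Proof.
move=> g; have [p ->] := pi1_class_surj g; rewrite pi1_mul_class.
by apply/pi1_classP; rewrite /= cats0; apply: homotopic_refl.
Qed.

Lemma pi1_mulgV : right_inverse pi1_one pi1_inv pi1_mul.
Proof.
move=> g; have [p ->] := pi1_class_surj g; rewrite pi1_inv_class pi1_mul_class.
exact/pi1_classP/homotopic_backtrack.
Qed.

Lemma pi1_invK : involutive pi1_inv.
Proof.
move=> g; have [p ->] := pi1_class_surj g; rewrite !pi1_inv_class.
apply/pi1_classP; rewrite /= (cw_rev_cons (cw_rev p)) /= cw_rev_cons revK.
exact: homotopic_refl.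
Qed.

Lemma pi1_mulVg : left_inverse pi1_one pi1_inv pi1_mul.
Proof. by move=> g; rewrite -[X in pi1_mul _ X]pi1_invK pi1_mulgV. Qed.

HB.instance Definition _ := isGroup.Build pi1
  pi1_mulA pi1_mul1g pi1_mulg1 pi1_mulVg pi1_mulgV.

End FundamentalGroup.

Definition torsion (G : groupType) : Prop :=
  forall g : G, exists2 n : nat, 0 < n & (g ^+ n = 1)%g.

(* Main.v *)
Require Import Defs.
From mathcomp Require Import all_boot all_order all_algebra.
From mathcomp Require Import boolp classical_sets constructive_ereal.
From mathcomp Require Import zify.

(** A 3-coloring is a graph homomorphism to the triangle; lifting a walk along
    the covering of the triangle by the line gives it an integer winding number,
    each edge contributing 1 or -1.  Substitutions change the winding number by
    a multiple of 3 lying in {-4, -2, 0, 2, 4}, hence not at all, so winding is a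
    homomorphism from the fundamental group to the integers.  It vanishes when
    the group is torsion; since it has the parity of the length, all closed
    walks are then even and the graph is bipartite. *)

Set Implicit Arguments.
Unset Strict Implicit.
Unset Printing Implicit Defensive.

Import GRing.Theory.
Local Open Scope ring_scope.

Lemma colorable_leq (X : sgraph) (k m : nat) :
  (k <= m)%N -> colorable X k -> colorable X m.
Proof.
move=> km [c cP]; exists (fun x => widen_ord km (c x)) => x y xy.
by move=> /(congr1 val) /= e; apply: (cP x y xy); apply: val_inj.
Qed.

(** The lift of [j - i] modulo 3 to {-1, 0, 1}; the value 0 occurs only for [i = j], hence on no
    edge of a proper coloring. *)
Definition color_step (i j : 'I_3) : int :=
  if j == ordS i then 1 else if i == ordS j then -1 else 0.

Lemma color_stepC (i j : 'I_3) : color_step j i = - color_step i j.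
Proof. by move: i j => [[|[|[|//]]] ?] [[|[|[|//]]] ?]. Qed.

(** Both sides are congruent to [l - i] modulo 3 and lie in {-2, 0, 2}, whose elements are distinct
    modulo 3; the proof enumerates the cases. *)
Lemma color_step_sub (i j k l : 'I_3) :
  i != j -> j != l -> i != k -> k != l ->
  color_step i j + color_step j l = color_step i k + color_step k l.
Proof.
by move: i j k l =>
  [[|[|[|//]]] ?] [[|[|[|//]]] ?] [[|[|[|//]]] ?] [[|[|[|//]]] ?].
Qed.

Lemma color_step_odd (i j : 'I_3) : i != j -> odd `|color_step i j|%N.
Proof. by move: i j => [[|[|[|//]]] ?] [[|[|[|//]]] ?]. Qed.

Section Winding.
Variables (X : sgraph) (c : X -> 'I_3).
Hypothesis c_proper : forall x y : X, adj x y -> c x <> c y.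

Fixpoint winding (x : X) (p : seq X) : int :=
  if p is y :: q then color_step (c x) (c y) + winding y q else 0.

(** Moves relate whole vertex lists, first vertex included; 0 on the empty list is a dummy value. *)
Definition walk_winding (s : seq X) : int :=
  if s is x :: p then winding x p else 0.

Lemma winding_cat (x : X) (p q : seq X) :
  winding x (p ++ q) = winding x p + winding (last x p) q.
Proof. by elim: p x => [|y p IH] x /=; rewrite ?add0r // IH addrA. Qed.

Lemma winding_odd (x : X) (p : seq X) :
  path (@adj X) x p -> odd `|winding x p|%N = odd (size p).
Proof.
elim: p x => [//|y p IH] x /= /andP[/c_proper/eqP/color_step_odd xy /IH].
by lia.
Qed.

Lemma walk_winding_move (s t : seq X) :
  sorted (@adj X) s -> move s t -> walk_winding s = walk_winding t.
Proof.
move=> ss st; case: st ss => {s t} [s t x v w y xw wy|s t v w vw|s t v w] ss.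
- have E : color_step (c x) (c v) + color_step (c v) (c y) =
           color_step (c x) (c w) + color_step (c w) (c y).
    have /and3P[xv vy _] := (cat_sorted2 ss).2.
    by apply: color_step_sub; apply/eqP/c_proper.
  by case: s {ss} => [|a s] /=; rewrite ?winding_cat /=; lia.
(* The detour [v w v] contributes two opposite steps. *)
- have E := color_stepC (c v) (c w).
  by case: s {ss} => [|a s] /=; rewrite ?winding_cat /= E; lia.
- have E := color_stepC (c v) (c w).
  by case: s {ss} => [|a s] /=; rewrite ?winding_cat /= E; lia.
Qed.

Lemma walk_winding_homotopic (s t : seq X) :
  sorted (@adj X) s -> homotopic s t -> walk_winding s = walk_winding t.
Proof.
(* Invariance under a move is known for walks only, so being a walk is carried through the
   induction. *)
move=> ss st; suff [] : sorted (@adj X) t /\ walk_winding s = walk_winding t.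
  by [].
elim: st ss => {s t} [s t st ss|s ss|s t u _ IH1 _ IH2 /IH1[/IH2[? <-] ->]] //.
by split; [apply: sorted_move st ss|apply: walk_winding_move st].
Qed.

Variable v0 : X.

Definition pi1_winding (g : pi1 v0) : int := winding v0 (walk_tail (repr g)).

Lemma pi1_winding_class (p : closed_walk v0) :
  pi1_winding (pi1_class p) = winding v0 (walk_tail p).
Proof.
by apply: (walk_winding_homotopic _ (pi1_reprP p)); apply: walk_path.
Qed.

Lemma pi1_windingM (g h : pi1 v0) :
  pi1_winding (g * h)%g = pi1_winding g + pi1_winding h.
Proof. by rewrite pi1_winding_class winding_cat walk_last. Qed.

Lemma pi1_winding1 : pi1_winding 1%g = 0.
Proof. exact: (pi1_winding_class (cw_one v0)). Qed.

Lemma pi1_windingX (g : pi1 v0) (n : nat) :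
  pi1_winding (g ^+ n)%g = pi1_winding g *+ n.
Proof.
elim: n => [|n IH]; first by rewrite mulr0n expg0 pi1_winding1.
by rewrite expgS pi1_windingM IH mulrS.
Qed.

Lemma torsion_closed_walk_even (p : closed_walk v0) :
  torsion (pi1 v0) -> ~~ odd (size (walk_tail p)).
Proof.
move=> /(_ (pi1_class p))[n n_gt0 /(congr1 pi1_winding)].
rewrite -(winding_odd (walk_path p)) pi1_windingX pi1_winding1.
rewrite pi1_winding_class.
(* The integers are torsion-free: a positive multiple of the winding number vanishes, so it is
   itself 0, which is even. *)
move=> /eqP; rewrite Num.Theory.mulrn_eq0 -leqn0 leqNgt n_gt0 /=.
by move=> /eqP->.
Qed.

End Winding.

Lemma even_closed_walks_bipartite (X : sgraph) (v0 : X) :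
  connected X -> (forall p : closed_walk v0, ~~ odd (size (walk_tail p))) ->
  bipartite X.
Proof.
move=> Xconn even_cw.
(* The two sides consist of the ends of even and of odd walks from [v0]. *)
pose reach b := [set x | exists p : seq X,
  [/\ path (@adj X) v0 p, last v0 p = x & odd (size p) = b]]%classic.
have step b x y : adj x y -> reach b x -> reach (~~ b) y.
  move=> xy [p [pp px <-]]; exists (rcons p y).
  by rewrite rcons_path pp px xy last_rcons size_rcons.
exists (reach false), (reach true); split.
- apply/seteqP; split=> // x _; have [p pp px] := Xconn v0 x.
  by case E: (odd (size p)); [right|left]; exists p.
- apply/seteqP; split=> // x [[p [pp px p0]] [q [qq qx q1]]].
  (* An even walk [p] followed by the reverse of an odd walk [q] would be an odd closed walk at
     [v0]. *)
  have rP : path (@adj X) v0 (p ++ rev (belast v0 q)).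
    rewrite cat_path pp px -qx rev_path (eq_path (e' := @adj X)) //.
    by move=> ? ?; apply: adj_sym.
  have rL : last v0 (p ++ rev (belast v0 q)) = v0.
    rewrite last_cat px -qx.
    by case: (q) => [|y q'] //=; rewrite rev_cons last_rcons.
  have := even_cw (ClosedWalk rP rL).
  by rewrite /= size_cat size_rev size_belast oddD p0 q1.
- move=> x y xy; have [p pp px] := Xconn v0 x.
  case E: (odd (size p)); [right|left].
  + have rx : reach true x by exists p.
    by split=> //; apply: step xy rx.
  + have rx : reach false x by exists p.
    by split=> //; apply: step xy rx.
Qed.

Theorem theorem4p1 (X : sgraph) (v0 : X) :
  connected X -> ~ bipartite X -> torsion (pi1 v0) ->
  ((4 : int)%:E <= chromatic_number X)%E.
Proof.
move=> Xconn Xnbip Xtors; rewrite /chromatic_number.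
case: pselect => [h|_]; last exact: leey.
case: ex_minnP => k /asboolP kcol _; rewrite lee_fin lez_nat ltnNge.
apply/negP => k_le3; have [c cP] := colorable_leq (m := 3) k_le3 kcol.
apply/Xnbip/(even_closed_walks_bipartite (v0 := v0) Xconn) => p.
exact (torsion_closed_walk_even cP p Xtors).
Qed.
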